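(* Let $A\in\mathbb C^{6\times 6}$ be a partial isometry of rank three. If the Kippenhahn curve $C(A)$ contains a circle $\mathcal C_{a,r}$ ($a\in\mathbb C$, $r>0$), then this circle is centered at the origin, i.e. $a=0$.
   Context: A matrix $A$ is a partial isometry if $\|Ax\|=\|x\|$ for all $x\perp\ker A$. Put $\operatorname{Re}X=(X+X^* )/2$. The Kippenhahn polynomial of $A\in\mathbb C^{n\times n}$ is $P_A(\lambda,\theta)=\det(\operatorname{Re}(e^{i\theta}A)-\lambda I)$. With $\lambda_1(\theta),\dots,\lambda_n(\theta)$ its roots in $\lambda$, the Kippenhahn curve $C(A)$ is the envelope of the family of lines $\{e^{-i\theta}(\lambda_j(\theta)+i\mathbb R):\theta\in(-\pi,\pi],\ j=1,\dots,n\}$. $\mathcal C_{a,r}$ is the circle of radius $r>0$ centered at $a$, and $\mathcal C_r=\mathcal C_{0,r}$. The containment $C(A)\supset\mathcal C_r$ holds if and only if, for all $\theta$, $P_A(\lambda,\theta)$ is divisible by $\lambda^2-r^2$ as a polynomial in $\lambda$; and $C(A)\supset\mathcal C_{a,r}$ if and only if $C(A-aI)\supset\mathcal C_r$ (these may be taken as definitions). *)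

(* Defs.v *)
From mathcomp Require Import all_boot all_order all_algebra.
From mathcomp Require Import complex.
From mathcomp Require Import reals trigo.

Set Implicit Arguments.
Unset Strict Implicit.
Unset Printing Implicit Defensive.

Import Order.TTheory GRing.Theory Num.Theory.
Local Open Scope ring_scope.
Local Open Scope complex_scope.
Local Open Scope sesquilinear_scope.

(* Matrices act on column vectors; the library's hermitian product [dotmx] is
   stated for row vectors, hence the transposes below. *)

Definition cvdot (R : realType) (n : nat) (x y : 'cV[R[i]]_n) : R[i] :=
  dotmx x^T y^T.

Definition cvnorm (R : realType) (n : nat) (x : 'cV[R[i]]_n) : R[i] :=
  sqrtC (cvdot x x).

Definition perp_ker (R : realType) (m n : nat) (A : 'M[R[i]]_(m, n))
    (x : 'cV[R[i]]_n) : Prop :=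
  forall y : 'cV[R[i]]_n, A *m y = 0 -> cvdot x y = 0.

Definition partial_isometry (R : realType) (m n : nat)
    (A : 'M[R[i]]_(m, n)) : Prop :=
  forall x : 'cV[R[i]]_n, perp_ker A x -> cvnorm (A *m x) = cvnorm x.

Definition expi (R : realType) (t : R) : R[i] := cos t +i* sin t.

Definition mxRe (R : realType) (n : nat) (X : 'M[R[i]]_n) : 'M[R[i]]_n :=
  2^-1 *: (X + X ^t*).

(* [\det (H - 'X%:M)], which is [char_poly H] up to the sign [(-1) ^+ n]. *)
Definition kippenhahn_poly (R : realType) (n : nat) (A : 'M[R[i]]_n) (t : R) :
    {poly R[i]} :=
  \det (map_mx polyC (mxRe (expi t *: A)) - 'X%:M).

(* Containment of circles in the Kippenhahn curve C(A) is expressed through the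
   Kippenhahn polynomial, rather than by constructing the envelope C(A):
   the support lines of the circle of radius r centered at 0 correspond to the
   roots r and -r, present for every angle t; a general center a is reduced to
   the center 0 by translation. *)
Definition kippenhahn_contains_circle0 (R : realType) (n : nat)
    (A : 'M[R[i]]_n) (r : R) : Prop :=
  forall t : R, 'X^2 - ((r%:C) ^+ 2)%:P %| kippenhahn_poly A t.

Definition kippenhahn_contains_circle (R : realType) (n : nat)
    (A : 'M[R[i]]_n) (a : R[i]) (r : R) : Prop :=
  kippenhahn_contains_circle0 (A - a%:M) r.

(* Main.v *)
Require Import Defs.
From mathcomp Require Import all_boot all_order all_algebra.
From mathcomp Require Import complex.
From mathcomp Require Import reals trigo.
From mathcomp Require Import ring.

(** Write [A^*] for the adjoint of [A].  A partial isometry satisfies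
    [A A^* A = A] ([partial_isometry_adj]), so when its rank is [m] there are
    factorizations [A = U V] and [A^* = V' U'] through dimension [m] with
    [V V' = U' U = 1] ([partial_isometry_factor]).
    For a matrix of size [2 m], exchanging the factors turns
    [w A + w^-1 A^* - mu] into the block matrix with diagonal blocks [w C - mu]
    and [w^-1 C' - mu], where [C = V U] and [C' = U' V'], and with scalar
    off-diagonal blocks [w^-1] and [w].  If it is singular, so is
    its Schur complement [(w^-1 C' - mu) (w C - mu) - 1]
    ([det_compression_eq0]).

    If the curve of [A] contains the circle of center [a] and radius [r], these
    matrices are singular for every [w] on the unit circle with
    [mu = w a + w^-1 conj a + 2 r] ([contains_circle_det]).  Multiplying by
    [w^2] and putting [N = C - a], [N' = C' - conj a], the polynomial in [X]
      [det ((N' - s) (X^2 N - u) - X^2)],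
    with [s = X (2 r + a X)] and [u = conj a + 2 r X], vanishes on the unit
    circle, hence identically.

    Suppose now that [a <> 0], so that [u] has an inverse [v] modulo [X^4].
    Then [X^2 N - u] has inverse [- (v + v^2 X^2 N)] modulo [X^4], since the next
    term of the geometric series is already divisible by [X^4].  Multiplying by
    it gives [det (N' - (s - v X^2)) = 0] modulo [X^4]
    ([mulmx_inv_mod], [size_ge_of_det_eq0]).  As [r <> 0], the polynomial
    [s - v X^2] vanishes at [0] to order exactly one.  Substituting it
    into the characteristic polynomial of [N'] gives a multiple of [X^4], so that
    this nonzero polynomial of degree [m] vanishes at [0] to order at least [4]
    ([det_perturb_order]).  This is impossible for [m < 4], and here [m = 3]. *)

Set Implicit Arguments.
Unset Strict Implicit.
Unset Printing Implicit Defensive.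

Import Order.TTheory GRing.Theory Num.Theory.
Local Open Scope ring_scope.
Local Open Scope complex_scope.
Local Open Scope sesquilinear_scope.

(** * Determinants and orders of vanishing *)

Lemma dvdp_sub_prod (F : fieldType) (I : Type) (s : seq I) (d : {poly F})
    (f g : I -> {poly F}) :
  (forall i, d %| f i - g i) -> d %| \prod_(i <- s) f i - \prod_(i <- s) g i.
Proof.
move=> dfg; elim: s => [|i s IHs]; first by rewrite !big_nil subrr dvdp0.
rewrite !big_cons.
have -> : forall p q p' q' : {poly F},
    p * q - p' * q' = (p - p') * q + p' * (q - q').
  by move=> p q p' q'; rewrite mulrBl mulrBr addrA subrK.
by apply: dvdp_add; [apply: dvdp_mulr | apply: dvdp_mull].
Qed.

Lemma dvdp_sub_det (F : fieldType) (n : nat) (d : {poly F})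
    (A B : 'M[{poly F}]_n) :
  (forall i j, d %| A i j - B i j) -> d %| \det A - \det B.
Proof.
move=> dAB; rewrite /determinant -sumrB.
apply: (big_ind (fun p => d %| p)) => [||s _]; first by rewrite dvdp0.
  by move=> p q; apply: dvdp_add.
by rewrite -mulrBr dvdp_mull // dvdp_sub_prod.
Qed.

(** Up to the common factor ['X ^+ n], both sides are the determinant of the
    block matrix [M] below, computed by eliminating one or the other of its
    off-diagonal blocks. *)
Lemma char_poly_mulC (F : fieldType) (n : nat) (A B : 'M[F]_n) :
  char_poly (A *m B) = char_poly (B *m A).
Proof.
pose a := map_mx polyC A; pose b := map_mx polyC B.
pose M := block_mx 'X%:M a b 1%:M.
have detAB : \det M = char_poly (A *m B).
  have := det_mulmx (block_mx 1%:M (- a) 0 1%:M) M.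
  rewrite det_ublock !det1 !mul1r => <-.
  rewrite mulmx_block !mul1mx !mul0mx !add0r mulmx1 subrr det_lblock det1 mulr1.
  by rewrite mulNmx -map_mxM.
have detBA : 'X ^+ n * \det M = 'X ^+ n * char_poly (B *m A).
  have := det_mulmx (block_mx 1%:M 0 (- b) 'X%:M) M.
  rewrite det_lblock det1 mul1r det_scalar => <-.
  rewrite mulmx_block !mul1mx !mul0mx !addr0 mulNmx mulmx1 mulNmx.
  rewrite -scalar_mxC addNr det_ublock det_scalar -map_mxM /char_poly.
  by rewrite addrC.
by apply: (mulfI _ (etrans _ detBA)); rewrite ?detAB // expf_neq0 ?polyX_eq0.
Qed.

(** Elimination with the off-diagonal blocks as pivots: nothing is assumed of
    the diagonal blocks [P] and [Q]. *)
Lemma det_block_scalar_eq0 (F : fieldType) (m : nat) (P Q : 'M[F]_m) (w : F) :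
  w != 0 -> \det (block_mx P w^-1%:M w%:M Q) = 0 -> \det (Q *m P - 1%:M) = 0.
Proof.
move=> w0 detM0; pose L := block_mx 0 1%:M 1%:M (- (w *: P)).
have := det_mulmx (block_mx P w^-1%:M w%:M Q) L.
rewrite detM0 mul0r mulmx_block !mulmx0 !mulmx1 !add0r mulmxN mul_scalar_mx.
rewrite scalerA mulVf // scale1r subrr det_lblock det_scalar.
move/eqP; rewrite mulf_eq0 expf_eq0 invr_eq0 (negPf w0) andbF /=.
rewrite mulmxN -scalemxAr.
have -> : w%:M - w *: (Q *m P) = (- w) *: (Q *m P - 1%:M).
  by rewrite scalerBr scalemx1 scaleNr raddfN opprK addrC.
by rewrite detZ mulf_eq0 expf_eq0 oppr_eq0 (negPf w0) andbF => /eqP.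
Qed.

(** Composition with a polynomial of order exactly one at the origin preserves
    the order of vanishing there, which is at most the degree. *)
Lemma dvdp_Xn_comp (F : fieldType) (p g : {poly F}) (k : nat) :
  p != 0 -> ~~ root g 0 -> 'X ^+ k %| p \Po ('X * g) -> (k < size p)%N.
Proof.
move=> p0 g0; have [m [q /implyP/(_ p0) q0 Dp]] := multiplicity_XsubC p 0.
rewrite Dp subr0 in p0 *.
rewrite comp_polyM comp_Xn_poly exprMn mulrCA mulrA.
have cop (f : {poly F}) : ~~ root f 0 -> coprimep ('X ^+ k) f.
  by move=> f0; rewrite coprimep_expl // coprimep_sym coprimepX.
rewrite Gauss_dvdpl; last by rewrite cop // rootE horner_exp expf_neq0.
rewrite Gauss_dvdpl; last first.
  by rewrite cop // rootE horner_comp hornerM hornerX mul0r.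
rewrite dvdp_Pexp2l ?size_polyX // => le_km.
have q1 : q != 0 by apply: contraNneq p0 => ->; rewrite mul0r.
rewrite size_Mmonic ?monicXn // size_polyXn addnS /=.
by rewrite -add1n leq_add // size_poly_gt0.
Qed.

(** A matrix whose polynomial perturbation [N - g + O(X^k)] is singular modulo
    [X^k], for some [g] of order exactly one, has size at least [k]. *)
Lemma det_perturb_order (F : fieldType) (m k : nat) (N : 'M[F]_m)
    (g : {poly F}) (Z : 'M[{poly F}]_m) :
  ~~ root g 0 ->
  'X ^+ k %| \det (map_mx polyC N - ('X * g)%:M + 'X ^+ k *: Z) ->
  (k <= m)%N.
Proof.
move=> g0 dZ; rewrite -ltnS -(size_char_poly N).
apply: (dvdp_Xn_comp _ g0); first by rewrite -size_poly_gt0 size_char_poly.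
have -> : char_poly N \Po ('X * g)
        = (-1) ^+ m * \det (map_mx polyC N - ('X * g)%:M).
  rewrite -detZ scaleN1r opprB /char_poly -(det_map_mx (comp_poly _)).
  congr (\det _); apply/matrixP=> i j; rewrite !mxE.
  by rewrite rmorphB rmorphMn /= comp_polyX comp_polyC.
apply: dvdp_mull; set M := (_ - _) in dZ *.
rewrite -(subKr (\det (M + 'X ^+ k *: Z)) (\det M)).
apply: dvdp_sub => //; apply: dvdp_sub_det => i j.
by rewrite mxE addrAC subrr add0r mxE dvdp_mulIl.
Qed.

(** Modulo [x ^+ 4], where [v] is the inverse of [u], the inverse of
    [x ^+ 2 *: n - u%:M] is [- (v%:M + (v ^+ 2 * x ^+ 2) *: n)]: its geometric
    series stops after two terms. *)
Lemma mulmx_inv_mod (T : comNzRingType) (m : nat) (n n' : 'M[T]_m)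
    (x s u v y : T) :
  v * u + y * x ^+ 4 = 1 ->
  exists K, exists Z,
    ((n' - s%:M) *m (x ^+ 2 *: n - u%:M) - (x ^+ 2)%:M) *m K
      = n' - (s - v * x ^+ 2)%:M + x ^+ 4 *: Z.
Proof.
have [e scalarE] : exists e : 'M[T]_m, forall a, a%:M = a *: e.
  by exists 1%:M => a; rewrite scalemx1.
move=> uvE; pose K := v%:M + (v ^+ 2 * x ^+ 2) *: n.
pose W := y%:M + (v * y * x ^+ 2) *: n + v ^+ 2 *: (n *m n).
exists (- K); exists (v ^+ 2 *: n - (n' - s%:M) *m W).
have inv_mod : (x ^+ 2 *: n - u%:M) *m K = x ^+ 4 *: W - 1%:M.
  rewrite /K /W mulmxBl !mulmxDr !mul_scalar_mx -!scalemxAl.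
  rewrite -!scalemxAr !mul_mx_scalar !scalarE.
  move: (n *m n) => nn; apply/matrixP=> i j; rewrite !mxE.
  apply/eqP; rewrite -subr_eq0; apply/eqP.
  transitivity ((1 - (v * u + y * x ^+ 4)) * (e i j + v * x ^+ 2 * n i j)).
    by ring.
  by rewrite uvE subrr mul0r.
rewrite mulmxN mulmxBl -mulmxA inv_mod mulmxBr mulmx1 -scalemxAr mul_scalar_mx.
rewrite /K !scalarE; move: (_ *m W) => nW.
by apply/matrixP=> i j; rewrite !mxE; ring.
Qed.

(** The key step: as [b] is nonzero, the second factor is invertible modulo
    ['X ^+ 4]; dividing by it leaves [N'] perturbed by a scalar polynomial that,
    as [c] is nonzero, has order exactly one. *)
Lemma size_ge_of_det_eq0 (F : fieldType) (m : nat) (N N' : 'M[F]_m)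
    (a b c : F) :
  b != 0 -> c != 0 ->
  \det ((map_mx polyC N' - ('X * (c%:P + a%:P * 'X))%:M)
          *m ('X ^+ 2 *: map_mx polyC N - (b%:P + c%:P * 'X)%:M)
        - ('X ^+ 2)%:M) = 0 ->
  (4 <= m)%N.
Proof.
move=> b0 c0; set u := b%:P + _ => detG0.
have cop : coprimep u ('X ^+ 4).
  rewrite coprimep_expr // coprimepX.
  by rewrite rootE hornerD hornerM hornerX !hornerC mulr0 addr0.
have [[v y] /= uvE] := Bezout_eq1_coprimepP _ _ cop.
have [K [Z GK]] := mulmx_inv_mod (map_mx polyC N) (map_mx polyC N')
  ('X * (c%:P + a%:P * 'X)) uvE.
apply: (@det_perturb_order _ _ _ N' (c%:P + a%:P * 'X - v * 'X) Z).
  rewrite rootE !(hornerD, hornerN, hornerM, hornerX, hornerC).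
  by rewrite !mulr0 subr0 addr0.
have -> : 'X * (c%:P + a%:P * 'X - v * 'X)
        = 'X * (c%:P + a%:P * 'X) - v * 'X ^+ 2.
  by rewrite mulrBr expr2 mulrCA.
by rewrite -GK det_mulmx detG0 mul0r dvdp0.
Qed.

(** * Factoring a partial isometry through its rank *)

Lemma adjmxM (C : numClosedFieldType) (m n p : nat) (A : 'M[C]_(m, n))
    (B : 'M[C]_(n, p)) :
  (A *m B)^t* = B^t* *m A^t*.
Proof. by rewrite trmx_mul map_mxM. Qed.

Lemma adjmxD (C : numClosedFieldType) (m n : nat) (A B : 'M[C]_(m, n)) :
  (A + B)^t* = A^t* + B^t*.
Proof. by rewrite !raddfD. Qed.

Lemma adjmxB (C : numClosedFieldType) (m n : nat) (A B : 'M[C]_(m, n)) :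
  (A - B)^t* = A^t* - B^t*.
Proof. by rewrite !raddfB. Qed.

Lemma mulmx_adj_eq0 (C : numClosedFieldType) (m n : nat) (A : 'M[C]_(m, n)) :
  A *m A^t* = 0 -> A = 0.
Proof.
move=> AA0; apply/row_matrixP=> i; rewrite row0; apply/eqP/negPn/negP.
move/dotmx_is_dotmx; rewrite dotmxE.
rewrite !rowE adjmxM mulmxA -(mulmxA (delta_mx _ _)) AA0.
by rewrite mulmx0 mul0mx mxE ltxx.
Qed.

Lemma hermitian_form_eq0 (C : numClosedFieldType) (n : nat) (Q : 'M[C]_n) :
  Q^t* = Q -> (forall z : 'rV[C]_n, z *m Q *m z^t* = 0) -> Q = 0.
Proof.
move=> QQ Q0; apply/row_matrixP=> i; rewrite row0 rowE.
move: (delta_mx _ _) => z; apply: mulmx_adj_eq0.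
(* Polarization, with second vector [z *m Q]. *)
have := Q0 (z + z *m Q).
rewrite adjmxD !mulmxDl !mulmxDr !Q0 add0r addr0 adjmxM QQ -!mulmxA -mulr2n.
by rewrite -scaler_nat => /eqP; rewrite scaler_eq0 pnatr_eq0 => /eqP.
Qed.

(** The isometry condition on the vectors [A^* z], which are orthogonal to the
    kernel, says that the hermitian matrices [H *m H] and [H] below define the
    same quadratic form. *)
Lemma partial_isometry_adj (R : realType) (m n : nat) (A : 'M[R[i]]_(m, n)) :
  partial_isometry A -> A *m A^t* *m A = A.
Proof.
(* The transpose [B] acts on row vectors, as the hermitian product expects. *)
move=> isoA; pose B := A^T; have AE : A = B^T by rewrite trmxK.
have trC (p q : nat) (M : 'M[R[i]]_(p, q)) : (M^T)^t* = (M^t*)^T.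
  by rewrite map_trmx.
pose H := B^t* *m B.
have HE : H^t* = H by rewrite adjmxM trmxCK.
have form_eq (z : 'rV_m) : z *m H *m H *m z^t* = z *m H *m z^t*.
  have perp : perp_ker A (A^t* *m z^T).
    move=> y Ay0; rewrite /cvdot dotmxE trmx_mul trmxK -trC -mulmxA -adjmxM.
    by rewrite -trmx_mul Ay0 trmx0 trmx0 raddf0 mulmx0 mxE.
  have /sqrtC_inj := isoA _ perp.
  have xE : (A^t* *m z^T)^T = z *m B^t* by rewrite trmx_mul trmxK -trC.
  have AxE : (A *m (A^t* *m z^T))^T = z *m H by rewrite trmx_mul xE -mulmxA.
  rewrite /cvdot !dotmxE AxE xE (adjmxM z H) HE (adjmxM z) trmxCK => E.
  rewrite [LHS]mx11_scalar [RHS]mx11_scalar; congr (_%:M).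
  by rewrite /H !mulmxA in E *.
have HH : H *m H = H.
  apply/eqP; rewrite -subr_eq0; apply/eqP/hermitian_form_eq0.
    by rewrite adjmxB adjmxM HE.
  by move=> z; rewrite mulmxBr mulmxBl mulmxA form_eq subrr.
have BBB : B *m H = B.
  have D0 : (B *m H - B)^t* = 0.
    apply: mulmx_adj_eq0; rewrite trmxCK adjmxB (adjmxM B H) HE.
    rewrite mulmxBr !mulmxBl.
    rewrite -!(mulmxA H (B^t*)) !(mulmxA (B^t*) B) -/H.
    by rewrite !HH !subrr.
  apply/eqP; rewrite -subr_eq0 -[B *m H - B]trmxCK D0.
  by rewrite trmx0 raddf0.
transitivity (B *m H)^T; last by rewrite BBB -AE.
by rewrite trmx_mul /H trmx_mul -trC -AE.
Qed.

Lemma rank_factor (F : fieldType) (m n p : nat) (A : 'M[F]_(m, n)) :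
  \rank A = p ->
  exists U : 'M_(m, p), exists V : 'M_(p, n),
    [/\ A = U *m V, row_full U & row_free V].
Proof.
move=> <-; exists (col_base A), (row_base A).
by rewrite mulmx_base col_base_full row_base_free.
Qed.

(** From any rank factorization [A = U *m V], the relation [A A^* A = A] makes
    the Gram matrices [G] of [V] and [K] of [U] inverse to each other; inserting
    them in [A^* = V^* U^*] normalizes the mixed products to the identity
    without orthonormalizing [U] and [V]. *)
Lemma partial_isometry_factor (C : numClosedFieldType) (n m : nat)
    (A : 'M[C]_n) :
  A *m A^t* *m A = A -> \rank A = m ->
  exists U : 'M_(n, m), exists V : 'M_(m, n),
  exists U' : 'M_(m, n), exists V' : 'M_(n, m),
    [/\ A = U *m V, A^t* = V' *m U', V *m V' = 1%:M & U' *m U = 1%:M].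
Proof.
move=> AAA /rank_factor[U [V [AE /row_fullP[Ul UlK] /row_freeP[Vr VrK]]]].
pose G := V *m V^t*; pose K := U^t* *m U.
have GK : G *m K = 1%:M.
  have := congr1 (fun M => Ul *m M *m Vr) AAA.
  rewrite /= AE adjmxM /G /K !mulmxA UlK mul1mx -!(mulmxA _ V Vr) VrK.
  by rewrite !mulmx1.
have KG : K *m G = 1%:M by apply: mulmx1C.
exists U, V, (G *m U^t*), (V^t* *m K); split => //.
- by rewrite mulmxA -(mulmxA _ K) KG mulmx1 AE adjmxM.
- by rewrite mulmxA.
- by rewrite -mulmxA.
Qed.

(** * From circles to polynomial identities *)

Lemma horner_det (F : fieldType) (n : nat) (M : 'M[{poly F}]_n) (x : F) :
  (\det M).[x] = \det (map_mx (fun p => p.[x]) M).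
Proof. by rewrite -[LHS]/(horner_eval x _) -det_map_mx. Qed.

Lemma horner_char_poly (F : fieldType) (n : nat) (A : 'M[F]_n) (x : F) :
  (char_poly A).[x] = \det (x%:M - A).
Proof.
rewrite /char_poly horner_det; congr (\det _).
by apply/matrixP=> i j; rewrite !mxE hornerD hornerN hornerMn hornerX hornerC.
Qed.

Lemma map_horner_factored (F : fieldType) (m : nat) (N N' : 'M[F]_m)
    (s u p : {poly F}) (w : F) :
  map_mx (horner_eval w)
    ((map_mx polyC N' - s%:M) *m ('X ^+ 2 *: map_mx polyC N - u%:M) - p%:M)
  = (N' - s.[w]%:M) *m (w ^+ 2 *: N - u.[w]%:M) - p.[w]%:M.
Proof.
have evC (B : 'M_m) : map_mx (horner_eval w) (map_mx polyC B) = B.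
  by apply/matrixP=> i j; rewrite !mxE /horner_eval hornerC.
rewrite map_mxB map_mxM !map_mxB map_mxZ !map_scalar_mx !evC.
by rewrite rmorphXn /= /horner_eval hornerX.
Qed.

(** The reduction to half the size: the eigenvalues of [w A + w^-1 A'] are
    governed by the compressions [V *m U] and [U' *m V'] alone. *)
Lemma det_compression_eq0 (F : fieldType) (m : nat)
    (U V' : 'M[F]_(m + m, m)) (V U' : 'M[F]_(m, m + m)) (w mu : F) :
  V *m V' = 1%:M -> U' *m U = 1%:M -> w != 0 ->
  \det (w *: (U *m V) + w^-1 *: (V' *m U') - mu%:M) = 0 ->
  \det ((w^-1 *: (U' *m V') - mu%:M) *m (w *: (V *m U) - mu%:M) - 1%:M) = 0.
Proof.
move=> VV' U'U w0; pose X := row_mx (w *: U) (w^-1 *: V').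
pose Y := col_mx V U'.
have detB (M N : 'M[F]_(m + m)) : \det (M - N) = 0 -> \det (N - M) = 0.
  by move=> M0; rewrite -opprB -scaleN1r detZ M0 mulr0.
have -> : w *: (U *m V) + w^-1 *: (V' *m U') = X *m Y.
  by rewrite mul_row_col -!scalemxAl.
move/detB; rewrite -horner_char_poly char_poly_mulC horner_char_poly => /detB.
rewrite mul_col_row -!scalemxAr VV' U'U !scalemx1 scalar_mx_block.
rewrite opp_block_mx add_block_mx !oppr0 !addr0.
by apply: det_block_scalar_eq0.
Qed.

Lemma expi_conj (R : realType) (t : R) : expi t * Num.conj (expi t) = 1.
Proof.
rewrite -[Num.conj _]/((expi t)^*) /expi; simpc.
by rewrite -!expr2 cos2Dsin2 (mulrC (sin t)) addNr.
Qed.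

Lemma expi_neq0 (R : realType) (t : R) : expi t != 0.
Proof.
by apply: contra_eq_neq (expi_conj t) => ->; rewrite mul0r eq_sym oner_eq0.
Qed.

Lemma conj_expi (R : realType) (t : R) : Num.conj (expi t) = (expi t)^-1.
Proof. by rewrite -[RHS]mulr1 -(expi_conj t) mulKf ?expi_neq0. Qed.

(** The unit circle is infinite: it has a point of real part [1 / (k + 1)] for
    every [k]. *)
Lemma poly_expi_eq0 (R : realType) (p : {poly R[i]}) :
  (forall t, root p (expi t)) -> p = 0.
Proof.
move=> p0; apply/eqP/negPn/negP => pn0.
pose x (k : nat) : R := k.+1%:R^-1.
have xI k : x k \in `[-1, 1].
  rewrite in_itv /= (@le_trans _ _ 0) ?oppr_le0 ?invr_ge0 ?ler0n //=.
  by rewrite invf_le1 ?ltr0n // ler1n.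
pose s := [seq expi (acos (x k)) | k <- iota 0 (size p)].
suff : (size s < size p)%N by rewrite size_map size_iota ltnn.
apply: max_poly_roots => //; first by apply/allP=> _ /mapP[k _ ->].
rewrite map_inj_uniq ?iota_uniq // => k l /(congr1 (@complex.Re _)) /=.
by rewrite !acosK // => /invr_inj /eqP; rewrite eqr_nat eqSS => /eqP.
Qed.

(** Only the root [r] of the Kippenhahn polynomial of [A - a%:M] is needed; the
    root [-r] occurs at the opposite angle. *)
Lemma contains_circle_det (R : realType) (n : nat) (A : 'M[R[i]]_n) (a : R[i])
    (r t : R) :
  kippenhahn_contains_circle A a r ->
  \det (expi t *: A + (expi t)^-1 *: A^t*
        - (expi t * a + (expi t)^-1 * Num.conj a + 2 * r%:C)%:M) = 0.
Proof.
move/(_ t) => /dvdpP[q Pq].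
have := congr1 (fun p => p.[r%:C]) Pq.
rewrite hornerM hornerD hornerN hornerXn hornerC subrr mulr0 horner_det.
set w := expi t => det0.
rewrite (_ : _ - _ = 2 *: map_mx (fun p => p.[r%:C])
    (map_mx polyC (mxRe (w *: (A - a%:M))) - 'X%:M)).
  by rewrite detZ det0 mulr0.
apply/matrixP=> i j; rewrite !mxE.
rewrite hornerD hornerN hornerMn hornerX hornerC.
rewrite rmorphM rmorphB rmorphMn /= -/(Num.conj _) conj_expi.
rewrite -/w eq_sym; have w0 : w != 0 by apply: expi_neq0.
by case: (j == i); rewrite ?mulr1n ?mulr0n ?subr0; field.
Qed.

(** The statement holds for all partial isometries of size [2 m] and rank [m]
    with [m] at most three. *)
Lemma center_eq0 (R : realType) (m : nat) (A : 'M[R[i]]_(m + m))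
    (a : R[i]) (r : R) :
  partial_isometry A -> \rank A = m -> (m < 4)%N -> 0 < r ->
  kippenhahn_contains_circle A a r -> a = 0.
Proof.
move=> /partial_isometry_adj AAA rkA m4 r0 circ; apply/eqP/negPn/negP=> a0.
have [U [V [U' [V' [AE A'E VV' U'U]]]]] := partial_isometry_factor AAA rkA.
suff : (4 <= m)%N by rewrite leqNgt m4.
pose b := Num.conj a.
apply: (@size_ge_of_det_eq0 _ m (V *m U - a%:M) (U' *m V' - b%:M)
          a b (2 * r%:C)).
- by rewrite conjC_eq0.
- by rewrite mulf_neq0 ?pnatr_eq0 // gt_eqF // ltcR.
apply: poly_expi_eq0 => t; set w := expi t.
have w0 : w != 0 by apply: expi_neq0.
have := contains_circle_det t circ.
rewrite -/w -/b A'E {1}AE => /(det_compression_eq0 VV' U'U w0).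
set mu := (_ + 2 * _); set c := 2 * r%:C in mu *; set M := _ - _ => det0.
rewrite rootE horner_det.
rewrite (_ : map_mx _ _ = w ^+ 2 *: M); first by rewrite detZ det0 mulr0.
(* Each of the two factors of [M] takes one factor [w]. *)
rewrite -[LHS]/(map_mx (horner_eval w) _) map_horner_factored.
rewrite !(hornerD, hornerM, hornerX, hornerC) -expr2.
have -> : U' *m V' - b%:M - (w * (c + a * w))%:M
        = w *: (w^-1 *: (U' *m V') - mu%:M).
  apply/matrixP=> i j; rewrite !mxE /mu; move: (\sum_k _) => s.
  by case: (i == j); rewrite ?mulr1n ?mulr0n ?subr0; field.
have -> : w ^+ 2 *: (V *m U - a%:M) - (b + c * w)%:M
        = w *: (w *: (V *m U) - mu%:M).
  apply/matrixP=> i j; rewrite !mxE /mu; move: (\sum_k _) => s.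
  by case: (i == j); rewrite ?mulr1n ?mulr0n ?subr0; field.
by rewrite -scalemxAl -scalemxAr scalerA -expr2 scalerBr scalemx1.
Qed.

Theorem theorem4p3 (R : realType) (A : 'M[R[i]]_6) (a : R[i]) (r : R)
    (hA : partial_isometry A) (hrank : \rank A = 3%N) (hr : 0 < r)
    (hcirc : kippenhahn_contains_circle A a r) :
  a = 0.
Proof. exact: (@center_eq0 R 3 A a r). Qed.
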